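(* Let $\bar\rho$ be the solution on $\mathbb{R}^2\times[0,\infty)$ of the 2D Navier–Stokes equation in vorticity form $$\partial_t\bar\rho+(K*\bar\rho)\cdot\nabla\bar\rho=\Delta\bar\rho,\qquad \bar\rho(\cdot,0)=\bar\rho_0,\qquad K(x)=\frac1{2\pi}\frac{(-x_2,x_1)}{|x|^2},$$ where the initial vorticity $\bar\rho_0$ satisfies the growth condition $|\nabla\log\bar\rho_0(x)|^2\le C_1(1+|x|^2)$ for all $x$, as well as the standing assumptions given in the context. Then there exists a constant $c_1$, independent of $x$ and $t$, such that for all $x\in\mathbb{R}^2$ and $t\ge0$ $$\bar\rho(x,t)\ge e^{-c_1(1+t)(1+|x|^2)} .$$
   Context: Standing assumptions: the viscosity is normalized to $\sigma=1$; $\bar\rho\ge0$, $\int_{\mathbb{R}^2}\bar\rho(x,t)\,dx=1$, $\bar\rho\in L^1\cap L^\infty(\mathbb{R}^2)$ in space, so that $\bar\rho$ is smooth and a classical solution for $t>0$. The initial datum $\bar\rho_0\in W^{2,\infty}(\mathbb{R}^2)$ is a probability density satisfying, for some positive constants $C_1,C_2,C_3$ and all $x$, $$|\nabla\log\bar\rho_0(x)|^2\le C_1(1+|x|^2),\qquad |\nabla^2\log\bar\rho_0(x)|\le C_2(1+|x|^2),\qquad \bar\rho_0(x)\le C_3\exp(-C_3^{-1}|x|^2).$$ Constants (such as $c_1$) depend only on $C_1,C_2,C_3,\|\bar\rho_0\|_{W^{2,\infty}}$. Convolution is in the space variable. *)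

(* Defs.v *)
From HB Require Import structures.
From mathcomp Require Import all_boot all_order all_algebra.
From mathcomp Require Import all_classical all_reals all_analysis.

Set Implicit Arguments.
Unset Strict Implicit.
Unset Printing Implicit Defensive.

Import Order.TTheory GRing.Theory Num.Theory.
Import numFieldNormedType.Exports.

Local Open Scope classical_set_scope.
Local Open Scope ring_scope.

Section Defs.
Context {R : realType}.

Notation plane := (R * R)%type.

Definition mu2 : {measure set (measurableTypeR R * measurableTypeR R) -> \bar R} :=
  (@lebesgue_measure R \x @lebesgue_measure R)%E.

(* The canonical norm of the product R * R is the sup norm, so the Euclidean
   norm is written out. *)
Definition sqnorm2 (x : plane) : R := x.1 ^+ 2 + x.2 ^+ 2.

Definition dir1 : plane := (1, 0).
Definition dir2 : plane := (0, 1).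

Definition laplacian (f : plane -> R) (x : plane) : R :=
  'D_dir1 ('D_dir1 f) x + 'D_dir2 ('D_dir2 f) x.

(* For A open this is the usual class C^k(A): all iterated directional
   derivatives of order at most k exist and are continuous on A. *)
Fixpoint Ck_on {V : normedModType R} (A : set V) (k : nat) (f : V -> R) : Prop :=
  (forall x, A x -> {for x, continuous f}) /\
  if k is k'.+1 then
    forall v : V, (forall x, A x -> derivable f x v) /\ Ck_on A k' ('D_v f)
  else True.

Definition smooth_on {V : normedModType R} (A : set V) (f : V -> R) : Prop :=
  forall k, Ck_on A k f.

Definition test_function (phi : plane -> R) : Prop :=
  smooth_on setT phi /\ compact (closure [set x | phi x != 0]).

Definition locally_integrable2 (f : plane -> R) : Prop :=
  forall K : set plane, compact K -> mu2.-integrable K (EFin \o f).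

(* g is the weak (distributional) derivative d_1^a d_2^b f. *)
Definition weak_derivative (a b : nat) (f g : plane -> R) : Prop :=
  [/\ locally_integrable2 f, locally_integrable2 g &
      forall phi, test_function phi ->
        \int[mu2]_(x in setT)
            (f x * iter a (fun h => 'D_dir1 h) (iter b (fun h => 'D_dir2 h) phi) x)
        = (-1) ^+ (a + b) * \int[mu2]_(x in setT) (g x * phi x)].

(* f is in W^{2,oo}, with norm max_{|alpha| <= 2} ||D^alpha f||_{L^oo} <= M. *)
Definition W2oo_norm_le (f : plane -> R) (M : R) : Prop :=
  forall a b : nat, (a + b <= 2)%N ->
    exists2 g, weak_derivative a b f g & ('N[mu2]_+oo[EFin \o g] <= M%:E)%E.

Definition probability_density (f : plane -> R) : Prop :=
  [/\ forall x, 0 <= f x, mu2.-integrable setT (EFin \o f) &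
      (\int[mu2]_x (f x)%:E = 1)%E].

(* Since / 0 = 0, the kernel takes the value 0 at its singularity. *)
Definition K1 (x : plane) : R := (2 * pi)^-1 * (- x.2 / sqnorm2 x).
Definition K2 (x : plane) : R := (2 * pi)^-1 * (x.1 / sqnorm2 x).

Definition convol (k f : plane -> R) (x : plane) : R :=
  \int[mu2]_(y in setT) (k (x - y) * f y).

Definition log_gradient_growth (C : R) (f : plane -> R) : Prop :=
  forall x, ('D_dir1 (@ln R \o f) x) ^+ 2 + ('D_dir2 (@ln R \o f) x) ^+ 2
            <= C * (1 + sqnorm2 x).

(* The matrix norm is the Frobenius norm. For f in W^{2,oo} the
   second derivatives are weak ones, so the bound can only be asked almost
   everywhere. *)
Definition log_hessian_growth (C : R) (f : plane -> R) : Prop :=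
  exists H11 H12 H22 : plane -> R,
    [/\ weak_derivative 2 0 (@ln R \o f) H11,
        weak_derivative 1 1 (@ln R \o f) H12,
        weak_derivative 0 2 (@ln R \o f) H22 &
        {ae mu2, forall x,
           Num.sqrt (H11 x ^+ 2 + 2 * H12 x ^+ 2 + H22 x ^+ 2)
           <= C * (1 + sqnorm2 x)}].

Definition gaussian_upper_bound (C : R) (f : plane -> R) : Prop :=
  forall x, f x <= C * expR (- (C^-1 * sqnorm2 x)).

(* An element of W^{2,oo}(R^2) is identified with its C^1 representative;
   positivity is implicit in the bounds on the derivatives of log rho0. *)
Record initial_vorticity (C1 C2 C3 M : R) (rho0 : plane -> R) : Prop := {
  init_C1 : Ck_on setT 1 rho0 ;
  init_W2oo : W2oo_norm_le rho0 M ;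
  init_density : probability_density rho0 ;
  init_pos : forall x, 0 < rho0 x ;
  init_log_gradient : log_gradient_growth C1 rho0 ;
  init_log_hessian : log_hessian_growth C2 rho0 ;
  init_gaussian : gaussian_upper_bound C3 rho0 }.

(* rho t x is the vorticity at time t and position x, and its values at t < 0
   play no role. Together with the unit mass, sol_Loo says that rho is in
   L^oo(0, T; L^1 n L^oo) for every T. *)
Record NS_vorticity_solution (rho0 : plane -> R) (rho : R -> plane -> R) : Prop := {
  sol_density : forall t, 0 <= t -> probability_density (rho t) ;
  sol_Loo : forall T, exists B : R, forall t, 0 <= t <= T ->
    ('N[mu2]_+oo[EFin \o rho t] <= B%:E)%E ;
  sol_continuous :
    {within [set tx : R * plane | 0 <= tx.1],
      continuous (fun tx : R * plane => rho tx.1 tx.2)} ;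
  sol_smooth :
    smooth_on [set tx : R * plane | 0 < tx.1]
      (fun tx : R * plane => rho tx.1 tx.2) ;
  sol_eq : forall t x, 0 < t ->
    derive1 (fun s => rho s x) t
    + (convol K1 (rho t) x * 'D_dir1 (rho t) x
       + convol K2 (rho t) x * 'D_dir2 (rho t) x)
    = laplacian (rho t) x ;
  sol_init : rho 0 = rho0 }.

End Defs.

(* Main.v *)
(* The Gaussian w(x,t) = exp(-A(1+|x|^2) - B t) satisfies
     w_t + u.grad w - Lap w = (-B - 2A u.x - 4A^2|x|^2 + 4A) w
                           <= (-B + 4A + |u|^2/4) w,
   so it is a strict subsolution as soon as the drift u is bounded and
   B > 4A + |u|^2/4. Since w vanishes at infinity and the solution rho is
   nonnegative, rho - w + eps is positive off a compact set, and the first and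
   second order conditions at a negative minimum contradict the equation: hence
   rho >= w if this holds at t = 0.

   The drift K * rho(t) is bounded by 2 pi sup rho(t) + 1, and sup rho(t) <= C3
   for all t by the same principle applied with the barrier
   C3 + eps e^(kt) (1+|x|^2), where k may depend on a bound of rho on [0,T].
   At t = 0 the lower bound follows by integrating the growth condition on
   grad log rho0 from a point of a fixed ball at which rho0 is bounded below;
   there is one because rho0 has mass 1 and a Gaussian upper bound. *)

Require Import Defs.
From mathcomp Require Import all_boot all_order all_algebra.
From mathcomp Require Import all_classical all_reals all_analysis.
From mathcomp Require Import measurable_realfun ess_sup_inf normal_distribution.
From mathcomp Require Import ring lra.
Import Order.TTheory GRing.Theory Num.Theory.
Import numFieldNormedType.Exports.
Local Open Scope classical_set_scope.
Local Open Scope ring_scope.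

Local Notation mplane R := (measurableTypeR R * measurableTypeR R)%type.

(** * The velocity field *)

(** The antiderivative [atan ((y - a) / |b|)] vanishes at [a] and tends to pi/2 at infinity. *)
Lemma integral_kernel_half_line {R : realType} (a b : R) : b != 0 ->
  (\int[@lebesgue_measure R]_(y in `[a, +oo[) (`|b| / ((y - a) ^+ 2 + b ^+ 2))%:E
   = (pi / 2)%:E)%E.
Proof.
move=> b0; have nb : 0 < `|b| by rewrite normr_gt0.
have b2 : 0 < b ^+ 2 by rewrite exprn_even_gt0.
have den (y : R) : (y - a) ^+ 2 + b ^+ 2 != 0.
  by rewrite gt_eqF // ltr_wpDl // sqr_ge0.
pose F (y : R) := atan ((y - a) / `|b|).
have dF (y : R) : is_derive y 1 F (`|b| / ((y - a) ^+ 2 + b ^+ 2)).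
  have -> : F = @atan R \o (fun y => (y - a) * `|b|^-1) by [].
  apply: is_derive_eq.
  rewrite /= /GRing.scale /=.
  have e : b ^+ 2 = `|b| ^+ 2 by rewrite real_normK // num_real.
  have := den y; rewrite e => d.
  have nb' : `|b| != 0 by rewrite gt_eqF.
  field.
  by rewrite d nb'.
have cF : continuous F.
  move=> y; apply: differentiable_continuous; apply/derivable1_diffP.
  exact: ex_derive.
rewrite (@ge0_continuous_FTC2y _ _ F a (pi / 2)).
- by rewrite /F subrr mul0r atan0 sube0.
- by move=> y _; rewrite divr_ge0 // addr_ge0 // sqr_ge0.
- apply: continuous_subspaceT => y.
  apply: cvgM; first exact: cvg_cst.
  apply: cvgV; first exact: den.
  apply: cvgD; last exact: cvg_cst.
  by apply: cvgM; apply: cvgB => //; apply: cvg_cst.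
- rewrite /F; apply: cvg_comp (@cvgy_atan R).
  apply: gt0_cvgMly; first by rewrite invr_gt0.
  apply/cvgryPge => A; near=> y.
  rewrite lerBrDr; near: y; apply: nbhs_pinfty_ge; exact: num_real.
- by move=> y _; exact: ex_derive.
- by apply: cvg_at_right_filter; exact: cF.
- by move=> y _; rewrite derive1E derive_val.
Unshelve. all: by end_near. Qed.

(** On nonnegative reals inversion is the power of exponent -1, including at 0, where both take the
    value 0. *)
Lemma measurable_inv_ge0 d (T : measurableType d) {R : realType} (f : T -> R) :
  (forall x, 0 <= f x) -> measurable_fun setT f ->
  measurable_fun setT (fun x => (f x)^-1).
Proof.
move=> f0 mf; rewrite (_ : (fun _ => _) = fun x => f x `^ (-1)).
  exact: (measurableT_comp (@measurable_powR R (-1))).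
by apply/funext => x; rewrite powR_inv1.
Qed.

Lemma measurable_kernel_section {R : realType} (a b : R) :
  measurable_fun [set: R] (fun y => (`|b| / ((a - y) ^+ 2 + b ^+ 2))).
Proof.
apply: measurable_funM; first exact: measurable_cst.
apply: measurable_inv_ge0; first by move=> y; rewrite addr_ge0 // sqr_ge0.
apply: measurable_funD; last exact: measurable_cst.
by apply: measurable_funX; apply: measurable_funB.
Qed.

(* The one-dimensional integrals of the singular kernel are bounded uniformly in
   the distance b to the line, which replaces its local integrability in polar
   coordinates: away from a strip of width 2 the kernel is at most 1. *)
Lemma integral_kernel_line {R : realType} (a b : R) :
  (\int[@lebesgue_measure R]_y (`|b| / ((a - y) ^+ 2 + b ^+ 2))%:E <= pi%:E)%E.
Proof.
have [->|b0] := eqVneq b 0.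
  by under eq_integral do rewrite normr0 mul0r; rewrite integral0 lee_fin pi_ge0.
have pos (y : R) : 0 <= `|b| / ((a - y) ^+ 2 + b ^+ 2).
  by rewrite divr_ge0 // addr_ge0 // sqr_ge0.
have dn (c y : R) : (c - y) ^+ 2 + b ^+ 2 != 0.
  by rewrite gt_eqF // ltr_wpDl ?sqr_ge0 // exprn_even_gt0.
have mG := measurable_kernel_section a b.
(* The line is cut at [a]; the reflection y -> -y carries the left half to the half line from [- a],
   so each half contributes pi/2. *)
rewrite -(@setUv _ `[a, +oo[) setCitvr.
rewrite ge0_integral_setU //=; last 3 first.
- by apply/measurable_EFinP; exact: measurable_funTS.
- by move=> y _; rewrite lee_fin.
- rewrite disj_set2E; apply/eqP/seteqP; split=> // y /= [].
  by rewrite !in_itv /= andbT => h1 h2; move: (lt_le_trans h2 h1); rewrite ltxx.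
rewrite integral_itv_bndo_bndc; last by apply/measurable_EFinP; exact: measurable_funTS.
rewrite -{3}(opprK a) ge0_integration_by_substitutionNy; last 2 first.
- apply: continuous_subspaceT => y.
  apply: cvgM; first exact: cvg_cst.
  apply: cvgV; first exact: dn.
  apply: cvgD; last exact: cvg_cst.
  by apply: cvgM; apply: cvgB => //; apply: cvg_cst.
- by move=> y _; exact: pos.
rewrite [X in (X + _ <= _)%E](_ : _ = (pi / 2)%:E); last first.
  rewrite -(integral_kernel_half_line a b b0).
  by apply: eq_integral => y _; rewrite -sqrrN opprB.
rewrite [X in (_ + X <= _)%E](_ : _ = (pi / 2)%:E); last first.
  rewrite -(integral_kernel_half_line (- a) b b0).
  by apply: eq_integral => y _ /=; rewrite !opprK (addrC a).
by rewrite -EFinD lee_fin -splitr.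
Qed.

Lemma probability_density_measurable {R : realType} (f : R * R -> R) :
  probability_density f ->
  measurable_fun [set: mplane R] f.
Proof. by case=> _ /measurable_int /measurable_EFinP. Qed.

(** The kernel is split into an integrable part [g], paired with the bound [B] on [f], and a part at
    most 1, paired with the unit mass of [f]. *)
Lemma norm_convol_le {R : realType} (k g f : R * R -> R) (B I : R) (x : R * R) :
  probability_density f -> 0 <= B -> (forall y, f y <= B) ->
  measurable_fun [set: mplane R] (fun y : R * R => k (x - y)) ->
  measurable_fun [set: mplane R] g ->
  (forall y, 0 <= g y) -> (\int[@mu2 R]_y (g y)%:E <= I%:E)%E ->
  (forall y, `|k (x - y)| <= g y + 1) ->
  `|convol k f x| <= B * I + 1.
Proof.
move=> pf B0 fB mk mg g0 gI kg.
have mf := probability_density_measurable _ pf.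
have [f0 fi f1] := pf.
have bd : (\int[@mu2 R]_y `|(k (x - y) * f y)%:E| <= (B * I + 1)%:E)%E.
  apply: (@le_trans _ _ (\int[@mu2 R]_y (B%:E * (g y)%:E + (f y)%:E))%E).
    apply: ge0_le_integral => //.
    - apply: measurableT_comp => //.
      by apply/measurable_EFinP; exact: measurable_funM.
    - apply: emeasurable_funD; last exact/measurable_EFinP.
      by apply: emeasurable_funM; [exact: measurable_cst|exact/measurable_EFinP].
    - move=> y _; rewrite abse_EFin -EFinM -EFinD lee_fin normrM (ger0_norm (f0 y)).
      apply: (le_trans (ler_wpM2r (f0 y) (kg y))).
      rewrite mulrDl mul1r lerD2r mulrC.
      by apply: ler_wpM2r.
  rewrite ge0_integralD //=; last 4 first.
  - by move=> y _; rewrite -EFinM lee_fin mulr_ge0.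
  - by apply: emeasurable_funM; [exact: measurable_cst|exact/measurable_EFinP].
  - by move=> y _; rewrite lee_fin.
  - exact/measurable_EFinP.
  rewrite ge0_integralZl //=; last 2 first.
  - exact/measurable_EFinP.
  - by move=> y _; rewrite lee_fin.
  rewrite f1 EFinD EFinM leeD2r //.
  by apply: lee_wpmul2l; rewrite ?lee_fin.
have mkf : measurable_fun [set: mplane R] (fun y : R * R => (k (x - y) * f y)%:E).
  by apply/measurable_EFinP; exact: measurable_funM.
have := le_trans (le_abse_integral (@mu2 R) measurableT mkf) bd.
rewrite /convol /Rintegral.
by case: (integral _ _ _) => [r||] //=; rewrite lee_fin.
Qed.

Lemma sqnorm2_ge0 {R : realType} (x : R * R) : 0 <= sqnorm2 x.
Proof. by rewrite addr_ge0 // sqr_ge0. Qed.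

Lemma measurable_translated_inv_sqnorm2 {R : realType} (x : R * R) :
  measurable_fun [set: mplane R]
    (fun y : R * R => (sqnorm2 (x - y))^-1).
Proof.
apply: measurable_inv_ge0; first by move=> y; exact: sqnorm2_ge0.
apply: measurable_funD; apply: measurable_funX => /=.
  by apply: measurable_funB; [exact: measurable_cst|exact: measurable_fst].
by apply: measurable_funB; [exact: measurable_cst|exact: measurable_snd].
Qed.

(** Off the strip [|c - s| >= 1], so [|c - s| <= (c - s)^2 <= n]. With [n] the squared distance,
    this is the splitting that [norm_convol_le] asks for. *)
Lemma kernel_le_strip {R : realType} (c s n : R) : 0 <= n -> (c - s) ^+ 2 <= n ->
  `|c - s| / n <= (\1_(`]c - 1, c + 1[%classic) s : R) * (`|c - s| / n) + 1.
Proof.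
move=> n0 cn; rewrite indicE; case: (boolP (s \in _)).
  by move=> _; rewrite mul1r lerDl.
rewrite notin_setE /= in_itv /= => /negP; rewrite negb_and -!leNgt => h.
rewrite mul0r add0r.
have h1 : 1 <= `|c - s|.
  by case/orP: h => h; [rewrite ger0_norm|rewrite ler0_norm]; lra.
have h2 : `|c - s| <= `|c - s| ^+ 2 by rewrite expr2 ler_peMl.
rewrite ler_pdivrMr ?mul1r.
  by rewrite (le_trans h2) // real_normK // num_real.
by apply: lt_le_trans cn; rewrite -real_normK ?num_real // exprn_gt0 // (lt_le_trans ltr01).
Qed.

Lemma integral_strip_le {R : realType} (c : R) :
  (\int[@lebesgue_measure R]_s ((\1_(`]c - 1, c + 1[%classic) s * pi : R)%:E) <= (2 * pi)%:E)%E.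
Proof.
under eq_integral do rewrite EFinM muleC.
rewrite ge0_integralZl //=; last 2 first.
- by apply/measurable_EFinP; exact: measurable_indic.
- by rewrite lee_fin pi_ge0.
rewrite integral_indic //= setIT lebesgue_measure_itv /= lte_fin.
have -> : c - 1 < c + 1 by lra.
rewrite -EFinB -EFinM lee_fin.
have := pi_gt0 R; nra.
Qed.

Lemma measurable_strip_kernel1 {R : realType} (x : R * R) :
  measurable_fun [set: mplane R] (fun y : R * R =>
    (\1_(`]x.2 - 1, x.2 + 1[%classic) y.2 : R) * (`|x.2 - y.2| / sqnorm2 (x - y))).
Proof.
apply: measurable_funM.
  apply: (@measurableT_comp _ _ _ _ _ _ (\1_(`]x.2 - 1, x.2 + 1[%classic) : R -> R) _ snd).
    exact: measurable_indic.
  exact: measurable_snd.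
apply: measurable_funM; last exact: measurable_translated_inv_sqnorm2.
apply: measurableT_comp => //.
by apply: measurable_funB; [exact: measurable_cst|exact: measurable_snd].
Qed.

Lemma measurable_strip_kernel2 {R : realType} (x : R * R) :
  measurable_fun [set: mplane R] (fun y : R * R =>
    (\1_(`]x.1 - 1, x.1 + 1[%classic) y.1 : R) * (`|x.1 - y.1| / sqnorm2 (x - y))).
Proof.
apply: measurable_funM.
  apply: (@measurableT_comp _ _ _ _ _ _ (\1_(`]x.1 - 1, x.1 + 1[%classic) : R -> R) _ fst).
    exact: measurable_indic.
  exact: measurable_fst.
apply: measurable_funM; last exact: measurable_translated_inv_sqnorm2.
apply: measurableT_comp => //.
by apply: measurable_funB; [exact: measurable_cst|exact: measurable_fst].
Qed.

(** Integrating first in [y.1], each horizontal line contributes at most pi, and the strip has width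
    2. The second component is treated with the coordinates exchanged. *)
Lemma integral_strip_kernel1 {R : realType} (x : R * R) :
  (\int[@mu2 R]_y ((\1_(`]x.2 - 1, x.2 + 1[%classic) y.2 : R) *
     (`|x.2 - y.2| / sqnorm2 (x - y)))%:E <= (2 * pi)%:E)%E.
Proof.
rewrite fubini_tonelli2; last 2 first.
- by apply/measurable_EFinP; exact: measurable_strip_kernel1.
- by move=> y; rewrite lee_fin mulr_ge0 // divr_ge0 // sqnorm2_ge0.
apply: le_trans (integral_strip_le x.2).
apply: ge0_le_integral => //.
- move=> s _; apply: integral_ge0 => u _.
  by rewrite lee_fin mulr_ge0 // divr_ge0 // sqnorm2_ge0.
- apply: measurable_fun_fubini_tonelli_G.
    by apply/measurable_EFinP; exact: measurable_strip_kernel1.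
  by move=> y; rewrite lee_fin mulr_ge0 // divr_ge0 // sqnorm2_ge0.
- by apply/measurable_EFinP; apply: measurable_funM; [exact: measurable_indic|exact: measurable_cst].
move=> s _; rewrite /fubini_G /=.
under eq_integral do rewrite EFinM.
rewrite ge0_integralZl //=; last 2 first.
- by apply/measurable_EFinP; exact: measurable_kernel_section.
- by move=> u _; rewrite lee_fin divr_ge0 // sqnorm2_ge0.
rewrite EFinM; apply: lee_wpmul2l; first by rewrite lee_fin.
exact: integral_kernel_line.
Qed.

Lemma integral_strip_kernel2 {R : realType} (x : R * R) :
  (\int[@mu2 R]_y ((\1_(`]x.1 - 1, x.1 + 1[%classic) y.1 : R) *
     (`|x.1 - y.1| / sqnorm2 (x - y)))%:E <= (2 * pi)%:E)%E.
Proof.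
rewrite fubini_tonelli1; last 2 first.
- by apply/measurable_EFinP; exact: measurable_strip_kernel2.
- by move=> y; rewrite lee_fin mulr_ge0 // divr_ge0 // sqnorm2_ge0.
apply: le_trans (integral_strip_le x.1).
apply: ge0_le_integral => //.
- move=> s _; apply: integral_ge0 => u _.
  by rewrite lee_fin mulr_ge0 // divr_ge0 // sqnorm2_ge0.
- apply: measurable_fun_fubini_tonelli_F.
    by apply/measurable_EFinP; exact: measurable_strip_kernel2.
  by move=> y; rewrite lee_fin mulr_ge0 // divr_ge0 // sqnorm2_ge0.
- by apply/measurable_EFinP; apply: measurable_funM; [exact: measurable_indic|exact: measurable_cst].
move=> s _; rewrite /fubini_F /=.
under eq_integral do rewrite EFinM /sqnorm2 /= (addrC ((x.1 - s) ^+ 2)).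
rewrite ge0_integralZl //=; last 2 first.
- by apply/measurable_EFinP; exact: measurable_kernel_section.
- by move=> u _; rewrite lee_fin divr_ge0 // addr_ge0 // sqr_ge0.
rewrite EFinM; apply: lee_wpmul2l; first by rewrite lee_fin.
exact: integral_kernel_line.
Qed.

Lemma inv_2pi_bounds {R : realType} : 0 <= (2 * pi : R)^-1 <= 1.
Proof.
have p := pi_ge2 R.
by rewrite invr_ge0 mulr_ge0 ?pi_ge0 //= invf_le1; lra.
Qed.

Lemma norm_convolK1_le {R : realType} (f : R * R -> R) (B : R) (x : R * R) :
  probability_density f -> 0 <= B -> (forall y, f y <= B) ->
  `|convol K1 f x| <= B * (2 * pi) + 1.
Proof.
move=> pf B0 fB; apply: (norm_convol_le _ _ _ _ _ _ pf B0 fB _ (measurable_strip_kernel1 x) _ (integral_strip_kernel1 x)).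
- rewrite /K1; apply: measurable_funM; first exact: measurable_cst.
  apply: (@measurable_funM _ _ _ _ _ (fun y : R * R => (sqnorm2 (x - y))^-1)); last exact: measurable_translated_inv_sqnorm2.
  apply: measurableT_comp => //=.
  by apply: measurable_funB; [exact: measurable_cst|exact: measurable_snd].
- by move=> y; rewrite mulr_ge0 // divr_ge0 // sqnorm2_ge0.
move=> y; have /andP[p0 p1] := @inv_2pi_bounds R.
have n0 := sqnorm2_ge0 (x - y).
rewrite /K1 normrM (ger0_norm p0) normrM normrN normfV (ger0_norm n0).
apply: le_trans (ler_piMl _ p1) _; first by rewrite divr_ge0.
by apply: kernel_le_strip => //; rewrite lerDr sqr_ge0.
Qed.

Lemma norm_convolK2_le {R : realType} (f : R * R -> R) (B : R) (x : R * R) :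
  probability_density f -> 0 <= B -> (forall y, f y <= B) ->
  `|convol K2 f x| <= B * (2 * pi) + 1.
Proof.
move=> pf B0 fB; apply: (norm_convol_le _ _ _ _ _ _ pf B0 fB _ (measurable_strip_kernel2 x) _ (integral_strip_kernel2 x)).
- rewrite /K2; apply: measurable_funM; first exact: measurable_cst.
  apply: (@measurable_funM _ _ _ _ _ (fun y : R * R => (sqnorm2 (x - y))^-1)); last exact: measurable_translated_inv_sqnorm2.
  by apply: measurable_funB; [exact: measurable_cst|exact: measurable_fst].
- by move=> y; rewrite mulr_ge0 // divr_ge0 // sqnorm2_ge0.
move=> y; have /andP[p0 p1] := @inv_2pi_bounds R.
have n0 := sqnorm2_ge0 (x - y).
rewrite /K2 normrM (ger0_norm p0) normrM normfV (ger0_norm n0).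
apply: le_trans (ler_piMl _ p1) _; first by rewrite divr_ge0.
by apply: kernel_le_strip => //; rewrite lerDl sqr_ge0.
Qed.

(** * The initial datum *)

(** Directional difference quotients are ordinary ones of the restriction to a line, so the calculus
    below reduces to one variable. *)
Lemma line_quotient {R : realType} {V : normedModType R} (f : V -> R) (z v : V) (s : R) :
  (fun h : R => h^-1 *: (((fun r : R => f (z + r *: v)) \o shift s) (h *: (1 : R)) - f (z + s *: v)))
  = (fun h : R => h^-1 *: ((f \o shift (z + s *: v)) (h *: v) - f (z + s *: v))).
Proof.
apply/funext => h; congr (_ *: (_ - _)) => /=; congr f.
by rewrite [h *: 1]mulr1 scalerDl addrCA.
Qed.

Lemma derivable_line {R : realType} {V : normedModType R} (f : V -> R) (z v : V) (s : R) :
  derivable (fun r : R => f (z + r *: v)) s 1 <-> derivable f (z + s *: v) v.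
Proof. by rewrite /derivable line_quotient. Qed.

Lemma derive_line {R : realType} {V : normedModType R} (f : V -> R) (z v : V) (s : R) :
  'D_1 (fun r : R => f (z + r *: v)) s = 'D_v f (z + s *: v).
Proof. by rewrite /derive line_quotient. Qed.

Lemma is_derive_line {R : realType} {V : normedModType R} (f : V -> R) (z v : V) (s : R) :
  derivable f (z + s *: v) v ->
  is_derive s 1 (fun r : R => f (z + r *: v)) ('D_v f (z + s *: v)).
Proof.
by move=> d; split; [exact/derivable_line|exact: derive_line].
Qed.

Lemma is_derive_of_line {R : realType} {V : normedModType R} (f : V -> R) (z v : V) (d : R) :
  is_derive (0 : R) 1 (fun r : R => f (z + r *: v)) d -> is_derive z v f d.
Proof.
case=> /derivable_line; rewrite scale0r addr0 => h1 h2.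
by split=> //; rewrite -h2 derive_line scale0r addr0.
Qed.

Lemma derivable_ln_comp {R : realType} {V : normedModType R} (f : V -> R) (z v : V) :
  0 < f z -> derivable f z v -> derivable (@ln R \o f) z v.
Proof.
move=> fz df.
have h : is_derive (0 : R) 1 (fun r : R => f (z + r *: v)) ('D_v f z).
  have -> : 'D_v f z = 'D_v f (z + 0 *: v) by rewrite scale0r addr0.
  by apply: is_derive_line; rewrite scale0r addr0.
have l : is_derive (f (z + 0 *: v)) 1 (@ln R) (f (z + 0 *: v))^-1.
  by apply: is_derive1_ln; rewrite scale0r addr0.
by have [] := is_derive_of_line (@ln R \o f) z v _ (is_derive1_comp l h).
Qed.

(* Young's inequality on the increment, so that only the square of the
   derivative has to be controlled. *)
Lemma increment_line_ge {R : realType} {V : normedModType R} (f : V -> R) (z v : V) (a b K : R) :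
  (forall s : R, derivable f (z + s *: v) v) ->
  (forall s : R, s ^+ 2 <= a ^+ 2 + b ^+ 2 -> 'D_v f (z + s *: v) ^+ 2 <= K) ->
  f (z + b *: v) - f (z + a *: v) >= - (K / 2) - (a ^+ 2 + b ^+ 2).
Proof.
move=> df dK.
have main (c d : R) : c <= d ->
    (forall s : R, s ^+ 2 <= c ^+ 2 + d ^+ 2 -> 'D_v f (z + s *: v) ^+ 2 <= K) ->
    `|f (z + d *: v) - f (z + c *: v)| <= K / 2 + (c ^+ 2 + d ^+ 2).
  move=> cd Kcd.
  have [|s] := @MVT_segment R _ _ c d cd (fun s _ => is_derive_line f z v s (df s)).
    by apply: derivable_within_continuous => s _; exact/derivable_line.
  rewrite in_itv /= => /andP[cs sd] ->.
  have s2 : s ^+ 2 <= c ^+ 2 + d ^+ 2.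
    by have [s0|s0] := leP 0 s; nra.
  have := Kcd s s2; set D := 'D_v f _ => h.
  (* Here |D (d - c)| <= (D^2 + (d - c)^2) / 2 and (d - c)^2 <= 2 (c^2 + d^2). *)
  have := sqr_ge0 (D - (d - c)); have := sqr_ge0 (D + (d - c)).
  have := sqr_ge0 (c + d).
  by rewrite ler_norml => h1 h2 h3; apply/andP; split; nra.
have /orP[ab|ba] := le_total a b.
  by have := main a b ab dK; rewrite ler_norml => /andP[+ _]; lra.
have := main b a ba; rewrite (addrC (b ^+ 2)) => /(_ dK).
by rewrite ler_norml => /andP[_]; lra.
Qed.

(* Moving from y to x parallel to the axes avoids having to relate directional
   derivatives in different directions. *)
Lemma ln_lower_bound {R : realType} (C : R) (f : R * R -> R) (x y : R * R) :
  0 <= C -> Ck_on setT 1 f -> (forall z, 0 < f z) -> log_gradient_growth C f ->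
  ln (f x) >= ln (f y) - (C + 1) * (1 + sqnorm2 x + sqnorm2 y).
Proof.
move=> C0 [_ fC] f0 gf.
have df (z v : R * R) : derivable (@ln R \o f) z v.
  by apply: derivable_ln_comp => //; have [+ _] := fC v; apply.
(* [K] bounds the squared partial derivatives of [ln f] along the path from [y] through [(x.1, y.2)]
   to [x]; the two legs together cost at most K + |x|^2 + |y|^2. *)
pose K := C * (1 + sqnorm2 x + sqnorm2 y).
have h1 := increment_line_ge (@ln R \o f) (0, y.2) dir1 y.1 x.1 K (fun s => df _ _).
have h2 := increment_line_ge (@ln R \o f) (x.1, 0) dir2 y.2 x.2 K (fun s => df _ _).
have e1 (a b : R) : (0, b) + a *: dir1 = (a, b) :> R * R.
  apply: (f_equal2 pair) => /=; first by rewrite add0r; exact: mulr1.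
  by rewrite scaler0 addr0.
have e2 (a b : R) : (a, 0) + b *: dir2 = (a, b) :> R * R.
  apply: (f_equal2 pair) => /=; last by rewrite add0r; exact: mulr1.
  by rewrite scaler0 addr0.
move: h1 h2; rewrite !e1 !e2 -!surjective_pairing => h1 h2.
have {}h1 : - (K / 2) - (y.1 ^+ 2 + x.1 ^+ 2) <= ln (f (x.1, y.2)) - ln (f y).
  apply: h1 => s hs; rewrite e1.
  apply: le_trans (_ : C * (1 + sqnorm2 (s, y.2)) <= _).
    by apply: le_trans (gf (s, y.2)); rewrite lerDl sqr_ge0.
  rewrite /K /sqnorm2 /= ler_wpM2l //; have := sqr_ge0 x.2; lra.
have {}h2 : - (K / 2) - (y.2 ^+ 2 + x.2 ^+ 2) <= ln (f x) - ln (f (x.1, y.2)).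
  apply: h2 => s hs; rewrite e2.
  apply: le_trans (_ : C * (1 + sqnorm2 (x.1, s)) <= _).
    by apply: le_trans (gf (x.1, s)); rewrite lerDr sqr_ge0.
  rewrite /K /sqnorm2 /= ler_wpM2l //; have := sqr_ge0 y.1; lra.
by move: h1 h2; rewrite /K /sqnorm2 => h1 h2; lra.
Qed.

(** Otherwise [f] would lie below half of a Gaussian probability density everywhere, and integration
    would give 1 <= 1/2. *)
Lemma exists_ge_normal_pdf {R : realType} (s : R) (f : R * R -> R) :
  s != 0 -> probability_density f ->
  exists y, normal_pdf 0 s y.1 * normal_pdf 0 s y.2 / 2 <= f y.
Proof.
move=> s0 pf; have [f0 _ f1] := pf; apply: contrapT => /forallNP lt.
pose p := normal_pdf 0 s.
have p0 u : 0 <= p u := normal_pdf_ge0 0 s u.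
have mp : measurable_fun [set: R] p := measurable_normal_pdf 0 s.
have mg : measurable_fun [set: mplane R] (fun y : R * R => (p y.1 * p y.2 / 2)).
  apply: measurable_funM; last exact: measurable_cst.
  apply: measurable_funM.
    by apply: (@measurableT_comp _ _ _ _ _ _ p _ fst mp); exact: measurable_fst.
  by apply: (@measurableT_comp _ _ _ _ _ _ p _ snd mp); exact: measurable_snd.
have : (\int[@mu2 R]_y (f y)%:E <= \int[@mu2 R]_y (p y.1 * p y.2 / 2)%:E)%E.
  apply: ge0_le_integral => //.
  - by move=> y _; rewrite lee_fin.
  - by apply/measurable_EFinP; exact: probability_density_measurable.
  - exact/measurable_EFinP.
  - by move=> y _; rewrite lee_fin; have /negP := lt y; rewrite -ltNge => /ltW.
rewrite f1 fubini_tonelli1; last 2 first.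
- exact/measurable_EFinP.
- by move=> y; rewrite lee_fin divr_ge0 // mulr_ge0.
rewrite /fubini_F /=.
have -> : (fun x => \int[@lebesgue_measure R]_y (p x * p y / 2)%:E)%E = (fun x => (2^-1)%:E * (p x)%:E)%E.
  apply/funext => x.
  under eq_integral do rewrite mulrC mulrA EFinM.
  rewrite ge0_integralZl //=.
  - by rewrite integral_normal_pdf mule1 EFinM.
  - exact/measurable_EFinP.
  - by move=> u _; rewrite lee_fin.
  - by rewrite lee_fin mulr_ge0.
rewrite ge0_integralZl //=.
- by rewrite integral_normal_pdf mule1 lee_fin; lra.
- exact/measurable_EFinP.
- by move=> u _; rewrite lee_fin.
Qed.

(** With variance [C], the lower bound at the point found above decays like exp(-|y|^2 / (2C)),
    slower than the upper bound exp(-|y|^2 / C). Both can hold only for [y] in a fixed ball. The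
    squared radius and the lower bound are chosen before [f]. *)
Lemma density_lower_bound_somewhere {R : realType} (C : R) : 0 < C ->
  exists2 Nc : R * R, 0 <= Nc.1 /\ 0 < Nc.2 & forall f : R * R -> R,
    probability_density f -> gaussian_upper_bound C f ->
    exists2 y, sqnorm2 y <= Nc.1 & Nc.2 <= f y.
Proof.
move=> C0; pose s := Num.sqrt C.
have s0 : s != 0 by rewrite gt_eqF // sqrtr_gt0.
have s2 : s ^+ 2 = C by rewrite sqr_sqrtr // ltW.
have pk := normal_peak_gt0 s0; set p := normal_peak s in pk.
(* With q = |y|^2 / (2C), the two bounds give p^2 e^q <= 2C, so p^2 q <= 2C, that is |y|^2 <= N. *)
pose N := 4 * C ^+ 2 / p ^+ 2.
have N0 : 0 <= N by rewrite divr_ge0 ?sqr_ge0 // mulr_ge0 // sqr_ge0.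
exists (N, p ^+ 2 / 2 * expR (- (N / (2 * C)))) => /=.
  by split=> //; rewrite mulr_gt0 ?expR_gt0 // divr_gt0 // exprn_gt0.
move=> f pf gf; have [y] := exists_ge_normal_pdf s f s0 pf.
rewrite normal_pdfE // -/p /normal_fun !subr0 s2 => hy.
have {}hy : p ^+ 2 / 2 * expR (- (sqnorm2 y / (2 * C))) <= f y.
  apply: le_trans hy; rewrite le_eqVlt; apply/orP; left; apply/eqP.
  have -> : - (sqnorm2 y / (2 * C)) = - y.1 ^+ 2 / (C *+ 2) + - y.2 ^+ 2 / (C *+ 2).
    by rewrite /sqnorm2 -mulr_natl; field; rewrite gt_eqF.
  by rewrite expRD; ring.
have yN : sqnorm2 y <= N.
  have := le_trans hy (gf y).
  have -> : - (C^-1 * sqnorm2 y) = - (sqnorm2 y / (2 * C)) + - (sqnorm2 y / (2 * C)).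
    by field; rewrite gt_eqF.
  rewrite expRD mulrA ler_pM2r ?expR_gt0 // expRN ler_pdivlMr ?expR_gt0 // => h.
  have p2 : 0 < p ^+ 2 by rewrite exprn_gt0.
  have u1 := expR_ge1Dx (sqnorm2 y / (2 * C)).
  have {}h : p ^+ 2 * (sqnorm2 y / (2 * C)) <= 2 * C.
    have := ler_wpM2l (ltW p2) u1; lra.
  rewrite /N ler_pdivlMr //; move: h; rewrite mulrA ler_pdivrMr ?mulr_gt0 //.
  lra.
exists y => //; apply: le_trans hy; rewrite ler_pM2l; last first.
  by rewrite divr_gt0 // exprn_gt0.
by rewrite ler_expR lerN2 ler_pM2r // invr_gt0 mulr_gt0.
Qed.

Lemma initial_lower_bound {R : realType} (C1 C2 C3 M : R) : 0 < C1 -> 0 < C3 ->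
  exists2 A : R, 0 < A & forall rho0, initial_vorticity C1 C2 C3 M rho0 ->
    forall x, expR (- (A * (1 + sqnorm2 x))) <= rho0 x.
Proof.
move=> C10 C30; have [[N c] /= [N0 c0] pt] := density_lower_bound_somewhere C3 C30.
(* The first term pays for the path from [y] to [x], since 1 + |x|^2 + |y|^2 <= (1 + N)(1 + |x|^2);
   the second pays for the value [c] at [y]. *)
pose A := (C1 + 1) * (1 + N) + `|ln c| + 1.
have A0 : 0 < A by rewrite ltr_wpDl // addr_ge0 // mulr_ge0; lra.
exists A => // rho0 ini x.
have [y yN yc] := pt rho0 (init_density ini) (init_gaussian ini).
have p := init_pos ini.
have lb := ln_lower_bound C1 rho0 x y (ltW C10) (init_C1 ini) p (init_log_gradient ini).
have lc : ln c <= ln (rho0 y) by rewrite ler_ln // posrE.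
rewrite -[leRHS](lnK (p x)) ler_expR.
have x0 := sqnorm2_ge0 x; have y0 := sqnorm2_ge0 y.
have n1 : - `|ln c| <= ln c by rewrite lerNl -normrN ler_norm.
have n0 := normr_ge0 (ln c).
have h1 : (C1 + 1) * (1 + sqnorm2 x + sqnorm2 y) <= (C1 + 1) * (1 + N) * (1 + sqnorm2 x).
  by rewrite -mulrA ler_wpM2l //; [lra|nra].
have h2 : `|ln c| <= `|ln c| * (1 + sqnorm2 x) by rewrite ler_peMr //; lra.
rewrite /A; lra.
Qed.

(** * Minimum principle *)

(** A negative value can occur only in a compact box. The minimum over the box is then global on
    [0, T], and it is not at time 0. *)
Lemma parabolic_min_exists {R : realType} (F : R -> R * R -> R) (T r : R) :
  {within [set tx : R * (R * R) | 0 <= tx.1],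
    continuous (fun tx : R * (R * R) => F tx.1 tx.2)} ->
  (forall x, 0 <= F 0 x) ->
  (forall (t : R) (x : R * R), 0 <= t <= T -> r < `|x.1| \/ r < `|x.2| -> 0 <= F t x) ->
  (forall (t : R) (x : R * R), 0 < t <= T -> F t x < 0 ->
    ~ forall (s : R) (y : R * R), 0 <= s <= T -> F t x <= F s y) ->
  forall (t : R) (x : R * R), 0 <= t <= T -> 0 <= F t x.
Proof.
move=> cF F0 Ffar Fmin t0 x0 t0T; rewrite leNgt; apply/negP => neg.
pose K := `[0, T]%classic `*` (`[- r, r]%classic `*` `[- r, r]%classic) : set (R * (R * R)).
have inK s y : 0 <= s <= T -> F s y < 0 -> K (s, y).
  move=> sT sy; split => /=; first by rewrite in_itv.
  split; rewrite /= in_itv /= -ler_norml leNgt; apply/negP => h.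
    by have := Ffar s y sT (or_introl h); rewrite leNgt sy.
  by have := Ffar s y sT (or_intror h); rewrite leNgt sy.
have cK : compact K by do 2?apply: compact_setX; exact: segment_compact.
have K0 : K !=set0 by exists (t0, x0); exact: inK.
have cFK : {within K, continuous (fun tx : R * (R * R) => F tx.1 tx.2)}.
  by apply: continuous_subspaceW cF => -[s y] [/= + _]; rewrite in_itv => /andP[].
have [[t x]] := compact_EVT_min K0 cK cFK.
rewrite inE => -[/= + _]; rewrite in_itv /= => tT cmin.
have le0 : F t x <= F t0 x0 by have := cmin (t0, x0); apply; rewrite inE; exact: inK.
have tx0 := le_lt_trans le0 neg.
apply: (Fmin t x _ tx0).
  case/andP: tT => t_ge0 ->; rewrite andbT lt_neqAle t_ge0 andbT.
  by apply/eqP => te; move: tx0; rewrite -te ltNge F0.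
move=> s y sT; have [sy|sy] := leP 0 (F s y); first exact: le_trans (ltW tx0) sy.
by have := cmin (s, y); apply; rewrite inE; exact: inK.
Qed.

(** If d < 0, then [g1] is negative just to the right of 0, and the mean value theorem makes [g]
    drop below [g 0]. *)
Lemma second_derivative_test {R : realType} (g g1 : R -> R) (d : R) :
  (forall s : R, is_derive s 1 g (g1 s)) -> is_derive (0 : R) 1 g1 d ->
  (forall s, g 0 <= g s) -> g1 0 = 0 /\ 0 <= d.
Proof.
move=> dg [dg1 g1d] gmin.
have g10 : g1 0 = 0.
  have c01 : (0 : R) \in `](-1), 1[ by rewrite in_itv /=; apply/andP; split; lra.
  have le11 : (-1 : R) <= 1 by lra.
  have dg' (s : R) : s \in `](-1), 1[ -> derivable g s 1 by move=> _; have [] := dg s.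
  have [_ h] := derive1_at_min le11 dg' c01 (fun s _ => gmin s).
  by have [_ <-] := dg 0.
split=> //; rewrite leNgt; apply/negP => d0.
have : \forall h \near (0 : R)^', h^-1 *: (g1 (h *: 1 + 0) - g1 0) < 0.
  have := dg1; rewrite /derivable => /cvg_ex[l hl].
  have ld : l = d by rewrite -g1d; apply/esym/cvg_lim.
  by have := hl [set y | y < 0]; apply; apply: lt_nbhsl; rewrite ld.
case=> e /= e0 he.
have e2 : 0 < e / 2 by rewrite divr_gt0.
have [|c] := @MVT R g g1 0 (e / 2) e2 (fun s _ => dg s).
  by apply: derivable_within_continuous => s _; have [] := dg s.
rewrite in_itv /= subr0 => /andP[c0 ce] eq.
have : g1 c < 0.
  have := he c; rewrite /= g10 subr0 addr0 [_ *: 1]mulr1 sub0r normrN gtr0_norm //.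
  have -> : c < e by lra.
  move=> /(_ isT); rewrite gt_eqF // => /(_ isT).
  by have -> : c^-1 *: g1 c = c^-1 * g1 c by []; rewrite pmulr_rlt0 // invr_gt0.
move=> g1c; have := gmin (e / 2); have : g1 c * (e / 2) < 0 by rewrite pmulr_llt0.
by rewrite -eq; lra.
Qed.

(** Only earlier times are compared, because the minimum may sit at t = T; hence a sign instead of d
    = 0. *)
Lemma derivative_at_left_min {R : realType} (h : R -> R) (t T d : R) :
  0 < t <= T -> is_derive t 1 h d ->
  (forall s, 0 <= s <= T -> h t <= h s) -> d <= 0.
Proof.
move=> /andP[t0 tT] [dh hd] hmin; rewrite leNgt; apply/negP => d0.
have : \forall e \near (0 : R)^', 0 < e^-1 *: (h (e *: 1 + t) - h t).
  have := dh; rewrite /derivable => /cvg_ex[l hl].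
  have ld : l = d by rewrite -hd; apply/esym/cvg_lim.
  by have := hl [set y | 0 < y]; apply; apply: lt_nbhsr; rewrite ld.
case=> e /= e0 he.
(* The cap at [t] keeps the earlier time t - m nonnegative. *)
pose m := Num.min (e / 2) t.
have m0 : 0 < m by rewrite lt_min divr_gt0 // t0.
have me : m <= e / 2 by rewrite ge_min lexx.
have mt : m <= t by rewrite ge_min lexx orbT.
have := he (- m); rewrite /= sub0r opprK gtr0_norm // [_ *: 1]mulr1 oppr_eq0 gt_eqF //.
have -> : m < e by lra.
move=> /(_ isT isT).
have -> : (- m)^-1 *: (h (- m + t) - h t) = (- m)^-1 * (h (- m + t) - h t) by [].
rewrite nmulr_rgt0 ?invr_lt0 ?oppr_lt0 // subr_lt0 ltNge => /negP; apply.
by apply: hmin; apply/andP; split; lra.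
Qed.

(** The last hypothesis receives the first and second order conditions at a negative minimum. Each
    barrier supplies the contradiction there, from the equation. *)
Lemma parabolic_minimum_principle {R : realType}
    (F F1 F2 F11 F22 Ft : R -> R * R -> R) (T r : R) :
  {within [set tx : R * (R * R) | 0 <= tx.1],
    continuous (fun tx : R * (R * R) => F tx.1 tx.2)} ->
  (forall x, 0 <= F 0 x) ->
  (forall (t : R) (x : R * R), 0 <= t <= T -> r < `|x.1| \/ r < `|x.2| -> 0 <= F t x) ->
  (forall (t : R) (x : R * R), 0 < t -> is_derive x dir1 (F t) (F1 t x)) ->
  (forall (t : R) (x : R * R), 0 < t -> is_derive x dir2 (F t) (F2 t x)) ->
  (forall (t : R) (x : R * R), 0 < t -> is_derive x dir1 (F1 t) (F11 t x)) ->
  (forall (t : R) (x : R * R), 0 < t -> is_derive x dir2 (F2 t) (F22 t x)) ->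
  (forall (t : R) (x : R * R), 0 < t -> is_derive t 1 (F^~ x) (Ft t x)) ->
  (forall (t : R) (x : R * R), 0 < t <= T -> F t x < 0 -> F1 t x = 0 -> F2 t x = 0 ->
     0 <= F11 t x -> 0 <= F22 t x -> Ft t x <= 0 -> False) ->
  forall (t : R) (x : R * R), 0 <= t <= T -> 0 <= F t x.
Proof.
move=> cF F0 Ffar d1 d2 d11 d22 dt key.
apply: (parabolic_min_exists F T r cF F0 Ffar) => t x tT neg mn.
have t0 : 0 < t by case/andP: tT.
have tT' : 0 <= t <= T by case/andP: tT => /ltW -> ->.
have test v G (g : R) : (forall y, is_derive y v (F t) (G y)) -> is_derive x v G g ->
    G x = 0 /\ 0 <= g.
  move=> dF dG.
  have x0 : x + (0 : R) *: v = x by rewrite scale0r addr0.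
  have := @second_derivative_test R (fun s : R => F t (x + s *: v)) (fun s : R => G (x + s *: v)) g.
  rewrite x0; apply.
  - move=> s; have [a b] := dF (x + s *: v); rewrite -b; exact: is_derive_line.
  - case: dG => a <-; rewrite -{2}x0; apply: is_derive_line; by rewrite x0.
  - by move=> s; exact: mn.
have [e1 p1] := test _ _ _ (fun y => d1 t y t0) (d11 t x t0).
have [e2 p2] := test _ _ _ (fun y => d2 t y t0) (d22 t x t0).
apply: (key t x) => //.
by apply: (derivative_at_left_min (F^~ x) t T (Ft t x) tT (dt t x t0)) => s sT; exact: mn.
Qed.

(** * Regularity of solutions and comparison with barriers *)

(** The set where [f] exceeds [B] is open; if nonempty, it contains a ball, here a square, of
    positive measure. *)
Lemma ae_le_continuous_le {R : realType} (f : R * R -> R) (B : R) :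
  continuous f -> ('N[@mu2 R]_+oo[EFin \o f] <= B%:E)%E -> forall x, f x <= B.
Proof.
move=> cf nf x; rewrite leNgt; apply/negP => Bx.
have pos (e : R) : 0 < e -> (0 < @mu2 R (ball x e))%E.
  move=> e0; have -> : ball x e = ball x.1 e `*` ball x.2 e by [].
  have -> : @mu2 R (ball x.1 e `*` ball x.2 e) =
      ((@lebesgue_measure R \x @lebesgue_measure R) (ball x.1 e `*` ball x.2 e))%E by [].
  rewrite product_measure1E.
  - have b0 (c : R) : (0 < @lebesgue_measure R (ball c e))%E.
      by rewrite lebesgue_measure_ball ?ltW // lte_fin mulrn_wgt0.
    by apply: mule_gt0; exact: b0.
  - exact: measurable_ball.
  - exact: measurable_ball.
(* The L^oo norm unfolds to an essential supremum only on a space of positive measure. *)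
have muT : (0 < @mu2 R setT)%E.
  apply: (lt_le_trans (pos 1 ltr01)); apply: le_measure => //; rewrite inE //.
  by apply: measurableX; exact: measurable_ball.
have ae : {ae @mu2 R, forall y, (`|(f y)%:E| <= B%:E)%E}.
  move: nf; rewrite unlock muT => /ess_supP; exact.
have /nbhs_ballP[e /= e0 eB] : nbhs x [set y | B < f y].
  exact: (cf x _ (lt_nbhsr Bx)).
case: ae => N [mN N0 sub].
have : (@mu2 R (ball x e) <= @mu2 R N)%E.
  apply: le_measure; rewrite ?inE //.
    by apply: measurableX; exact: measurable_ball.
  move=> y xy; apply: sub => /=; apply/negP; rewrite -ltNge lte_fin.
  by apply: lt_le_trans (ler_norm _); exact: eB.
by rewrite N0 leNgt pos.
Qed.

(** Smoothness is joint in time and space; it is used in the direction [(0, d)], along which time is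
    frozen. *)
Lemma solution_is_derive_space {R : realType} (rho0 : R * R -> R) (rho : R -> R * R -> R)
    (t : R) (x d : R * R) : NS_vorticity_solution rho0 rho -> 0 < t ->
  is_derive x d (rho t) ('D_d (rho t) x) /\
  is_derive x d ('D_d (rho t)) ('D_d ('D_d (rho t)) x).
Proof.
move=> sol t0.
pose F (tx : R * (R * R)) := rho tx.1 tx.2.
pose v : R * (R * R) := (0, d).
have line (G : R * (R * R) -> R) (r : R) : G ((t, x) + r *: v) = G (t, x + r *: d).
  by congr G; apply: (f_equal2 pair) => //=; rewrite scaler0 addr0.
have restr (G : R * (R * R) -> R) : derivable G (t, x) v ->
    derivable (fun y => G (t, y)) x d.
  move=> dG.
  have := (derivable_line (fun y => G (t, y)) x d 0).1; rewrite scale0r addr0; apply.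
  rewrite (_ : (fun r => _) = fun r : R => G ((t, x) + r *: v)); last first.
    by apply/funext => r; rewrite line.
  by apply/derivable_line; rewrite scale0r addr0.
(* Both sides are limits of the same quotients, so the equality holds even where nothing is
   differentiable and can be differentiated again. *)
have DF : 'D_v F = fun tx => 'D_d (rho tx.1) tx.2.
  apply/funext => -[s y] /=.
  have := derive_line F (s, y) v 0; rewrite scale0r addr0 => <-.
  have := derive_line (rho s) y d 0; rewrite scale0r addr0 => <-.
  rewrite (_ : (fun r : R => F _) = fun r : R => rho s (y + r *: d)) //.
  by apply/funext => r; rewrite /F /= scaler0 addr0.
have [_ sm] := sol_smooth sol 2; have [dF [_ sm1]] := sm v; have [dF1 _] := sm1 v.
split; (split; last by []).
  exact: (restr F (dF (t, x) t0)).
by have := dF1 (t, x) t0; rewrite -/F DF => /restr.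
Qed.

Lemma solution_is_derive_time {R : realType} (rho0 : R * R -> R) (rho : R -> R * R -> R)
    (t : R) (x : R * R) : NS_vorticity_solution rho0 rho -> 0 < t ->
  is_derive t 1 (rho^~ x) (derive1 (rho^~ x) t).
Proof.
move=> sol t0; rewrite derive1E; split=> //.
pose F (tx : R * (R * R)) := rho tx.1 tx.2.
pose v : R * (R * R) := (1, 0).
have [_ sm] := sol_smooth sol 1; have [dF _] := sm v.
have := (derivable_line (rho^~ x) t 1 0).1; rewrite scale0r addr0; apply.
rewrite (_ : (fun r => _) = fun r : R => F ((t, x) + r *: v)); last first.
  by apply/funext => r; rewrite /F /= scaler0 addr0.
by apply/derivable_line; rewrite scale0r addr0; exact: (dF (t, x)).
Qed.

Lemma solution_continuous_space {R : realType} (rho0 : R * R -> R) (rho : R -> R * R -> R)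
    (t : R) : NS_vorticity_solution rho0 rho -> 0 < t -> continuous (rho t).
Proof.
move=> sol t0 x; have [c _] := sol_smooth sol 0.
apply: (@continuous_comp _ _ _ (fun y : R * R => (t, y)) (fun tx => rho tx.1 tx.2)).
  by apply: (@cvg_pair _ _ _ (nbhs x) (nbhs t) (nbhs x)); [exact: cvg_cst|exact: cvg_id].
exact: (c (t, x) t0).
Qed.

Lemma is_derive_quadratic {R : realType} (x d : R * R) (a b : R) :
  is_derive x d (fun y => a * sqnorm2 y + b) (a * (2 * (x.1 * d.1 + x.2 * d.2))).
Proof.
apply: is_derive_of_line.
have -> : (fun r => a * sqnorm2 (x + r *: d) + b) =
  (fun r : R => a * ((x.1 + r * d.1) ^+ 2 + (x.2 + r * d.2) ^+ 2) + b) by [].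
apply: is_derive_eq.
rewrite /GRing.scale /=.
ring.
Qed.

Lemma is_derive_linear {R : realType} (x d : R * R) (a b : R) :
  is_derive x d (fun y => a * y.1 + b * y.2) (a * d.1 + b * d.2).
Proof.
apply: is_derive_of_line.
have -> : (fun r => a * (x + r *: d).1 + b * (x + r *: d).2) =
  (fun r : R => a * (x.1 + r * d.1) + b * (x.2 + r * d.2)) by [].
apply: is_derive_eq.
rewrite /GRing.scale /=.
ring.
Qed.

Lemma continuous_sqnorm2 {R : realType} : continuous (@sqnorm2 R).
Proof.
move=> x; apply: cvgD; apply: cvgM; try exact: cvg_fst; exact: cvg_snd.
Qed.

(** * Supremum bound for the solution *)

Lemma drift_bound {R : realType} (U u1 u2 x1 x2 : R) : `|u1| <= U -> `|u2| <= U ->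
  - (U * (2 + (x1 ^+ 2 + x2 ^+ 2))) <= 2 * (u1 * x1 + u2 * x2).
Proof.
have one u z : `|u| <= U -> - (U * (1 + z ^+ 2)) <= 2 * (u * z).
  rewrite ler_norml => /andP[a b].
  have := sqr_ge0 (1 - z); have := sqr_ge0 (1 + z); nra.
by move=> /one h1 /one h2; have := h1 x1; have := h2 x2; lra.
Qed.

(** At the minimum the gradient of the solution is 2Ex, so the equation gives rt <= 4E + UE(2 +
    |x|^2). The rate 2U + 5 is chosen to exceed this. *)
Lemma sup_barrier_contradiction {R : realType} (E U rt r11 r22 v1 v2 x1 x2 : R) :
  0 < E -> `|v1| <= U -> `|v2| <= U ->
  rt + (v1 * (2 * E * x1 + 0 * x2) + v2 * (0 * x1 + 2 * E * x2)) = r11 + r22 ->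
  0 <= 2 * E - r11 -> 0 <= 2 * E - r22 ->
  (2 * U + 5) * E * (1 + (x1 ^+ 2 + x2 ^+ 2)) - rt <= 0 -> False.
Proof.
move=> E0 h1 h2 eq p1 p2 p3; have db := drift_bound U v1 v2 x1 x2 h1 h2.
have U0 : 0 <= U := le_trans (normr_ge0 _) h1.
have q0 : 0 <= x1 ^+ 2 + x2 ^+ 2 by rewrite addr_ge0 // sqr_ge0.
move: (x1 ^+ 2 + x2 ^+ 2) q0 p3 db => q q0 p3 db.
have := ler_wpM2l (ltW E0) db.
have := mulr_ge0 (ltW E0) q0; have := mulr_ge0 (mulr_ge0 (ltW E0) q0) U0.
lra.
Qed.

Lemma solution_sup_barrier {R : realType} (C B T e : R) (rho0 : R * R -> R)
    (rho : R -> R * R -> R) :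
  NS_vorticity_solution rho0 rho -> (forall x, rho0 x <= C) -> 0 <= C -> 0 <= B -> 0 < e ->
  (forall t x, 0 < t <= T -> rho t x <= B) ->
  forall (t : R) (x : R * R), 0 <= t <= T ->
  rho t x <= C + e * expR ((2 * (B * (2 * pi) + 1) + 5) * t) * (1 + sqnorm2 x).
Proof.
move=> sol rC C0 B0 e0 rB t x tT; rewrite -subr_ge0.
set U := B * (2 * pi) + 1; set K := 2 * U + 5.
have U0 : 0 <= U by rewrite addr_ge0 // mulr_ge0 // mulr_ge0 // pi_ge0.
have K0 : 0 <= K by rewrite /K; lra.
pose E (s : R) := e * expR (K * s).
have E0 s : 0 < E s by rewrite mulr_gt0 // expR_gt0.
pose F s (y : R * R) := C + E s * (1 + sqnorm2 y) - rho s y.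
rewrite -[_ - _]/(F t x).
apply: (parabolic_minimum_principle F
  (fun s y => 2 * E s * y.1 + 0 * y.2 - 'D_dir1 (rho s) y)
  (fun s y => 0 * y.1 + 2 * E s * y.2 - 'D_dir2 (rho s) y)
  (fun s y => 2 * E s - 'D_dir1 ('D_dir1 (rho s)) y)
  (fun s y => 2 * E s - 'D_dir2 ('D_dir2 (rho s)) y)
  (fun s y => K * E s * (1 + sqnorm2 y) - derive1 (rho^~ y) s) T (B / e + 1) _ _ _ _ _ _ _ _ _ t x tT).
- apply: within_continuousB; last exact: sol_continuous sol.
  apply: continuous_subspaceT => -[s y]; rewrite /F /E.
  apply: cvgD; first exact: cvg_cst.
  apply: cvgM.
    apply: cvgM; first exact: cvg_cst.
    apply: (@continuous_comp _ _ _ (fun z : R * (R * R) => K * z.1) expR) => /=; last exact: continuous_expR.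
    apply: cvgM; [exact: cvg_cst|exact: cvg_fst].
  apply: cvgD; first exact: cvg_cst.
  apply: (@continuous_comp _ _ _ (fun z : R * (R * R) => z.2) (@sqnorm2 R)); last exact: continuous_sqnorm2.
  exact: cvg_snd.
- move=> y; rewrite /F (sol_init sol) subr_ge0; apply: ler_wpDr (rC y).
  by rewrite mulr_ge0 ?(ltW (E0 _)) // addr_ge0 // sqnorm2_ge0.
- move=> s y sT far; rewrite subr_ge0.
  (* A coordinate beyond B/e + 1 is larger than 1, so its square is at least B/e, and e |y|^2 alone
     dominates [B]. *)
  have far' : B / e <= sqnorm2 y.
    have q0 : 0 <= B / e by rewrite divr_ge0 // ltW.
    have sq (z : R) : B / e + 1 < `|z| -> B / e <= z ^+ 2.
      by rewrite -(@real_normK _ z) ?num_real //; nra.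
    rewrite /sqnorm2; have := sqr_ge0 y.1; have := sqr_ge0 y.2.
    by case: far => /sq; lra.
  have bd : B <= E s * (1 + sqnorm2 y).
    move: far'; rewrite ler_pdivrMr // => h.
    have ge1 : 1 <= expR (K * s).
      by rewrite -expR0 ler_expR mulr_ge0 //; case/andP: sT.
    rewrite /E -mulrA (mulrC e) -mulrA.
    apply: le_trans (_ : (1 + sqnorm2 y) * e <= _); first by rewrite mulrDl; lra.
    by rewrite ler_peMl // mulr_ge0 ?(ltW e0) // addr_ge0 // sqnorm2_ge0.
  (* [B] bounds the solution at positive times only; at time 0 the bound [C] takes over. *)
  case/andP: sT; rewrite le_eqVlt => /orP[/eqP <- _|s0 sT].
    rewrite (sol_init sol); apply: ler_wpDr (rC y).
    by rewrite mulr_ge0 ?(ltW (E0 _)) // addr_ge0 // sqnorm2_ge0.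
  by apply: (le_trans (rB s y _)); rewrite ?s0 // ler_wpDl.
- move=> s y s0; have [d _] := solution_is_derive_space _ _ s y dir1 sol s0.
  have q := is_derive_quadratic y dir1 (E s) (C + E s).
  have -> : F s = (fun z => E s * sqnorm2 z + (C + E s)) - rho s.
    by apply/funext => z; rewrite /F !fctE; ring.
  by apply: is_derive_eq; rewrite /dir1 /=; ring.
- move=> s y s0; have [d _] := solution_is_derive_space _ _ s y dir2 sol s0.
  have q := is_derive_quadratic y dir2 (E s) (C + E s).
  have -> : F s = (fun z => E s * sqnorm2 z + (C + E s)) - rho s.
    by apply/funext => z; rewrite /F !fctE; ring.
  by apply: is_derive_eq; rewrite /dir2 /=; ring.
- move=> s y s0; have [_ d] := solution_is_derive_space _ _ s y dir1 sol s0.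
  have q := is_derive_linear y dir1 (2 * E s) 0.
  by apply: is_derive_eq; rewrite /dir1 /=; ring.
- move=> s y s0; have [_ d] := solution_is_derive_space _ _ s y dir2 sol s0.
  have q := is_derive_linear y dir2 0 (2 * E s).
  by apply: is_derive_eq; rewrite /dir2 /=; ring.
- move=> s y s0; have d := solution_is_derive_time _ _ s y sol s0.
  have q : is_derive s 1 (fun r : R => C + E r * (1 + sqnorm2 y)) (K * E s * (1 + sqnorm2 y)).
    rewrite /E; apply: is_derive_eq; rewrite /GRing.scale /=; ring.
  exact: is_deriveB.
move=> s y /andP[s0 sT] _ /subr0_eq d1 /subr0_eq d2 p1 p2 p3.
have := sol_eq sol y s0; rewrite /laplacian -d1 -d2 => eq.
have Br z : rho s z <= B by apply: rB; rewrite s0.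
have u1 := norm_convolK1_le (rho s) B y (sol_density sol (ltW s0)) B0 Br.
have u2 := norm_convolK2_le (rho s) B y (sol_density sol (ltW s0)) B0 Br.
exact: (sup_barrier_contradiction (E s) U _ _ _ _ _ y.1 y.2 (E0 s) u1 u2 eq p1 p2 p3).
Qed.

(** The a priori bound [B] depends on the solution and on [t], but it enters only the growth rate of
    the barrier and disappears as the factor in front tends to 0. *)
Lemma solution_le {R : realType} (C : R) (rho0 : R * R -> R) (rho : R -> R * R -> R)
    (t : R) (x : R * R) :
  NS_vorticity_solution rho0 rho -> (forall x, rho0 x <= C) -> 0 <= C -> 0 <= t ->
  rho t x <= C.
Proof.
move=> sol rC C0 t0; have [b hb] := sol_Loo sol t.
pose B := Num.max b 0.
have B0 : 0 <= B by rewrite le_max lexx orbT.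
have rB s y : 0 < s <= t -> rho s y <= B.
  case/andP => s0 st.
  apply: (ae_le_continuous_le (rho s) B (solution_continuous_space _ _ s sol s0)).
  apply: (le_trans (hb s _)); first by rewrite (ltW s0).
  by rewrite lee_fin le_max lexx.
set Z := expR ((2 * (B * (2 * pi) + 1) + 5) * t) * (1 + sqnorm2 x).
have Z0 : 0 < Z by rewrite mulr_gt0 ?expR_gt0 // ltr_wpDr // sqnorm2_ge0.
apply/ler_addgt0Pr => e e0.
have tt : 0 <= t <= t by rewrite t0 lexx.
have eZ : 0 < e / Z by rewrite divr_gt0.
have := solution_sup_barrier C B t (e / Z) rho0 rho sol rC C0 B0 eZ rB t x tt.
by rewrite -mulrA -/Z divfK // gt_eqF.
Qed.

(** * Gaussian lower bound *)

(* Completing the squares in 2 A x_i + v_i / 2. *)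
Lemma lower_barrier_contradiction {R : realType} (A U w rt r11 r22 v1 v2 x1 x2 : R) :
  0 < w -> `|v1| <= U -> `|v2| <= U ->
  rt + (v1 * (- (2 * A * x1 * w)) + v2 * (- (2 * A * x2 * w))) = r11 + r22 ->
  0 <= r11 - (4 * A ^+ 2 * x1 ^+ 2 - 2 * A) * w ->
  0 <= r22 - (4 * A ^+ 2 * x2 ^+ 2 - 2 * A) * w ->
  rt + (4 * A + U ^+ 2 + 1) * w <= 0 -> False.
Proof.
move=> w0 h1 h2 eq p1 p2 p3.
have sq v : `|v| <= U -> v ^+ 2 <= U ^+ 2.
  by move=> h; rewrite -(@real_normK _ v) ?num_real // ler_sqr // nnegrE (le_trans _ h).
have := sq _ h1; have := sq _ h2; have := sqr_ge0 U.
have := sqr_ge0 (2 * A * x1 + v1 / 2); have := sqr_ge0 (2 * A * x2 + v2 / 2).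
move=> s1 s2 s3 s4 s5.
(* The bracket expands to 4 A^2 |x|^2 + 2 A v.x + U^2 + 1, while the hypotheses force [w] times it
   to be at most 0. *)
have : 0 < w * ((2 * A * x1 + v1 / 2) ^+ 2 + (2 * A * x2 + v2 / 2) ^+ 2
    + (U ^+ 2 - v1 ^+ 2) / 4 + (U ^+ 2 - v2 ^+ 2) / 4 + U ^+ 2 / 2 + 1).
  by rewrite mulr_gt0 //; lra.
lra.
Qed.

Lemma is_derive_gaussian {R : realType} (x d : R * R) (a b : R) :
  is_derive x d (fun y => expR (- (a * sqnorm2 y + b)))
    (- (2 * a * (x.1 * d.1 + x.2 * d.2)) * expR (- (a * sqnorm2 x + b))).
Proof.
apply: is_derive_of_line.
have q := is_derive_line (fun y => a * sqnorm2 y + b) x d 0.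
move: q; rewrite scale0r addr0 => q.
have [dq eq] := is_derive_quadratic x d a b.
have {}q := q dq.
apply: is_derive_eq.
rewrite eq scale0r addr0 /GRing.scale /=.
ring.
Qed.

(** Since [C] bounds the solution at all times, the decay rate in [t] depends only on [A] and [C],
    not on [T] or [e]. *)
Lemma solution_lower_barrier {R : realType} (A C T e : R) (rho0 : R * R -> R)
    (rho : R -> R * R -> R) :
  NS_vorticity_solution rho0 rho -> 0 < A -> 0 <= C -> 0 < e ->
  (forall x, expR (- (A * (1 + sqnorm2 x))) <= rho0 x) ->
  (forall t x, 0 <= t -> rho t x <= C) ->
  forall (t : R) (x : R * R), 0 <= t <= T ->
  expR (- (A * sqnorm2 x + (A + (4 * A + (C * (2 * pi) + 1) ^+ 2 + 1) * t))) <= rho t x + e.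
Proof.
move=> sol A0 C0 e0 r0 rC t x tT; rewrite -subr_ge0.
set U := C * (2 * pi) + 1; set B := 4 * A + U ^+ 2 + 1.
have B0 : 0 <= B by have := sqr_ge0 U; rewrite /B; lra.
pose w s (y : R * R) := expR (- (A * sqnorm2 y + (A + B * s))).
have w0 s y : 0 < w s y := expR_gt0 _.
pose F s (y : R * R) := rho s y + e - w s y.
rewrite -[_ - _]/(F t x).
apply: (parabolic_minimum_principle F
  (fun s y => 'D_dir1 (rho s) y - (- (2 * A * y.1 * w s y)))
  (fun s y => 'D_dir2 (rho s) y - (- (2 * A * y.2 * w s y)))
  (fun s y => 'D_dir1 ('D_dir1 (rho s)) y - (4 * A ^+ 2 * y.1 ^+ 2 - 2 * A) * w s y)
  (fun s y => 'D_dir2 ('D_dir2 (rho s)) y - (4 * A ^+ 2 * y.2 ^+ 2 - 2 * A) * w s y)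
  (fun s y => derive1 (rho^~ y) s + B * w s y) T (1 / (A * e) + 1) _ _ _ _ _ _ _ _ _ t x tT).
- apply: within_continuousB.
    apply: within_continuousD; first exact: sol_continuous sol.
    by apply: continuous_subspaceT => z; exact: cvg_cst.
  apply: continuous_subspaceT => -[s y]; rewrite /w.
  apply: (@continuous_comp _ _ _ (fun z : R * (R * R) => - (A * sqnorm2 z.2 + (A + B * z.1))) expR) => /=; last exact: continuous_expR.
  apply: cvgN; apply: cvgD.
    apply: cvgM; first exact: cvg_cst.
    apply: (@continuous_comp _ _ _ (fun z : R * (R * R) => z.2) (@sqnorm2 R)); last exact: continuous_sqnorm2.
    exact: cvg_snd.
  apply: cvgD; first exact: cvg_cst.
  by apply: cvgM; [exact: cvg_cst|exact: cvg_fst].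
- move=> y; rewrite /F (sol_init sol) /w mulr0 addr0.
  have -> : A * sqnorm2 y + A = A * (1 + sqnorm2 y) by ring.
  by rewrite subr_ge0 ler_wpDr // ltW.
- move=> s y /andP[s0 _] far; rewrite subr_ge0.
  have far' : 1 / (A * e) <= sqnorm2 y.
    have q0 : 0 <= 1 / (A * e) by rewrite divr_ge0 // mulr_ge0 // ltW.
    have sq (z : R) : 1 / (A * e) + 1 < `|z| -> 1 / (A * e) <= z ^+ 2.
      by rewrite -(@real_normK _ z) ?num_real //; nra.
    rewrite /sqnorm2; have := sqr_ge0 y.1; have := sqr_ge0 y.2.
    by case: far => /sq; lra.
  have [r_ge0 _ _] := sol_density sol s0.
  apply: (@le_trans _ _ e); last by rewrite lerDr.
  (* Far out, A |y|^2 >= 1/e, and exp(z) >= 1 + z turns this into w <= e. *)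
  rewrite /w expRN -[leRHS]invrK lef_pV2 ?posrE ?invr_gt0 ?expR_gt0 //.
  apply: le_trans (expR_ge1Dx _).
  have Bs := mulr_ge0 B0 s0.
  move: far'; rewrite ler_pdivrMr ?mulr_gt0 // => h.
  apply: (@le_trans _ _ (A * sqnorm2 y)); last by lra.
  rewrite -[e^-1]mul1r ler_pdivrMr //.
  by have -> : A * sqnorm2 y * e = sqnorm2 y * (A * e) by ring.
- move=> s y s0; have [d _] := solution_is_derive_space _ _ s y dir1 sol s0.
  have q := is_derive_gaussian y dir1 A (A + B * s).
  have -> : F s = (rho s + cst e) - (fun z => expR (- (A * sqnorm2 z + (A + B * s)))) by [].
  by apply: is_derive_eq; rewrite /dir1 /w /=; ring.
- move=> s y s0; have [d _] := solution_is_derive_space _ _ s y dir2 sol s0.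
  have q := is_derive_gaussian y dir2 A (A + B * s).
  have -> : F s = (rho s + cst e) - (fun z => expR (- (A * sqnorm2 z + (A + B * s)))) by [].
  by apply: is_derive_eq; rewrite /dir2 /w /=; ring.
- move=> s y s0; have [_ d] := solution_is_derive_space _ _ s y dir1 sol s0.
  have q := is_derive_gaussian y dir1 A (A + B * s).
  have l := is_derive_linear y dir1 (2 * A) 0.
  (* Writing the gradient of the Gaussian as a linear function times the Gaussian allows the product
     rule. *)
  rewrite (_ : (fun z => _) = 'D_dir1 (rho s) +
    (fun z => 2 * A * z.1 + 0 * z.2) * (fun z => expR (- (A * sqnorm2 z + (A + B * s))))); last first.
    by apply/funext => z; rewrite !fctE /w; ring.
  apply: is_derive_eq; rewrite /dir1 /w /GRing.scale /=; ring.
- move=> s y s0; have [_ d] := solution_is_derive_space _ _ s y dir2 sol s0.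
  have q := is_derive_gaussian y dir2 A (A + B * s).
  have l := is_derive_linear y dir2 0 (2 * A).
  rewrite (_ : (fun z => _) = 'D_dir2 (rho s) +
    (fun z => 0 * z.1 + 2 * A * z.2) * (fun z => expR (- (A * sqnorm2 z + (A + B * s))))); last first.
    by apply/funext => z; rewrite !fctE /w; ring.
  apply: is_derive_eq; rewrite /dir2 /w /GRing.scale /=; ring.
- move=> s y s0; have d := solution_is_derive_time _ _ s y sol s0.
  have q : is_derive s 1 (fun r : R => e - w r y) (B * w s y).
    rewrite /w; apply: is_derive_eq; rewrite /GRing.scale /=; ring.
  rewrite (_ : F^~ y = rho^~ y + (fun r : R => e - w r y)); last first.
    by apply/funext => r; rewrite /F !fctE addrA.
  exact: is_deriveD.
move=> s y /andP[s0 sT] _ /subr0_eq d1 /subr0_eq d2 p1 p2 p3.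
have := sol_eq sol y s0; rewrite /laplacian d1 d2 => eq.
have Cr z : rho s z <= C by apply: rC; exact: ltW.
have u1 := norm_convolK1_le (rho s) C y (sol_density sol (ltW s0)) C0 Cr.
have u2 := norm_convolK2_le (rho s) C y (sol_density sol (ltW s0)) C0 Cr.
exact: (lower_barrier_contradiction A U (w s y) _ _ _ _ _ y.1 y.2 (w0 s y) u1 u2 eq p1 p2 p3).
Qed.

Theorem corollary3p4 (R : realType) (C1 C2 C3 M : R)
    (hC1 : 0 < C1) (hC2 : 0 < C2) (hC3 : 0 < C3) :
  exists c1 : R,
    forall (rho0 : R * R -> R) (rho : R -> R * R -> R),
      initial_vorticity C1 C2 C3 M rho0 ->
      NS_vorticity_solution rho0 rho ->
      forall (t : R) (x : R * R), 0 <= t ->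
        expR (- (c1 * (1 + t) * (1 + sqnorm2 x))) <= rho t x.
Proof.
have [A A0 hA] := initial_lower_bound C1 C2 C3 M hC1 hC3.
pose B := 4 * A + (C3 * (2 * pi) + 1) ^+ 2 + 1.
have B0 : 0 <= B by have := sqr_ge0 (C3 * (2 * pi) + 1); rewrite /B; lra.
(* The barrier exponent satisfies A|x|^2 + A + Bt <= (A + B)(1 + t)(1 + |x|^2). *)
exists (A + B) => rho0 rho ini sol t x t0.
have C30 := ltW hC3.
have rC y : rho0 y <= C3.
  apply: le_trans (init_gaussian ini y) _; rewrite ler_piMr // -expR0 ler_expR.
  by rewrite oppr_le0 mulr_ge0 ?invr_ge0 // sqnorm2_ge0.
apply/ler_addgt0Pr => e e0.
have tt : 0 <= t <= t by rewrite t0 lexx.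
apply: le_trans (solution_lower_barrier A C3 t e rho0 rho sol A0 C30 e0 (hA _ ini)
  (fun s y s0 => solution_le C3 rho0 rho s y sol rC C30 s0) t x tt).
rewrite -/B ler_expR lerN2.
have x0 := sqnorm2_ge0 x.
have := mulr_ge0 (ltW A0) (mulr_ge0 t0 x0); have := mulr_ge0 B0 (mulr_ge0 t0 x0).
have := mulr_ge0 (ltW A0) t0; have := mulr_ge0 B0 x0.
lra.
Qed.
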